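(* Let $s$ be the Brouwer threshold. Then every quiver $G$ with $\lambda_1(G)\le s$ satisfies $S_k(G)\le B_k(G)$ for all $1\le k\le n(G)$.
   Context: A quiver $G$ is a finite undirected graph with $n=n(G)\ge 1$ vertices in which loops (possibly several at the same vertex) and multiple edges between distinct vertices are allowed. $m$ is the total number of edges, where every loop and every edge of a multiple connection is counted. A finite simple graph is a quiver with no loops and no multiple connections. The Kirchhoff matrix $K$ of $G$ is the symmetric $n\times n$ matrix with $K_{ij}=-(\text{number of edges between } i \text{ and } j)$ for $i\neq j$, and $K_{ii}=$ the degree of vertex $i$, i.e. the number of edges attached to $i$, counted with multiplicity, where each loop at $i$ counts as $1$. Its eigenvalues are $\lambda_1(G)\ge\lambda_2(G)\ge\dots\ge\lambda_n(G)$, and $S_k(G)=\sum_{j=1}^k\lambda_j(G)$. The redundancy $r$ is the minimal number of edges whose removal leaves no multiple connections between distinct vertices; equivalently $r=\sum_{i<j}(\mathrm{sign}(K_{ij})-K_{ij})$ (multiple loops at a vertex do not count as redundant). Set $B_k(G)=m+r+k(k+1)/2$; for a finite simple graph $r=0$. The Brouwer threshold $s$ is the largest number (possibly $\infty$) such that, for all finite simple graphs $G$, the estimate $S_k(G)\le B_k(G)$ holds for all $k\le s$ (with $1\le k\le n(G)$). *)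

(* Defs.v *)
From HB Require Import structures.
From mathcomp Require Import all_boot all_order all_algebra.
From mathcomp Require Import spectral sesquilinear polyrcf complex.
From mathcomp Require Import boolp reals constructive_ereal.

Set Implicit Arguments.
Unset Strict Implicit.
Unset Printing Implicit Defensive.

Import Order.TTheory GRing.Theory Num.Theory.
Local Open Scope ring_scope.

(* An edge is sent to the set of its endpoints, so a loop is an edge with
   exactly one endpoint; several edges may have the same endpoints. *)
Record quiver := Quiver {
  nv : nat;
  edge : finType;
  ends : edge -> {set 'I_nv};
  nv_gt0 : (0 < nv)%N;
  card_ends : forall e, (0 < #|ends e| <= 2)%N
}.

Section Quivers.
Variable G : quiver.
Implicit Types (i j : 'I_(nv G)) (D : {set edge G}).

Definition ne : nat := #|edge G|.

Definition edges_between i j : {set edge G} :=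
  [set e | ends e == [set i; j]].

Definition degree i : nat := #|[set e : edge G | i \in ends e]|.

Definition no_multiple D : bool :=
  [forall i, forall j, (i != j) ==> (#|edges_between i j :&: D| <= 1)%N].

Definition loopless : bool := [forall e : edge G, #|ends e| == 2].

Definition simple : bool := loopless && no_multiple setT.

(* The candidate [setT] (remove every edge) is always admissible, so this is
   a genuine minimum. *)
Definition redundancy : nat :=
  #|[arg min_(D < setT | no_multiple (~: D)) #|D|]|.

Definition kirchhoff (R : pzRingType) : 'M[R]_(nv G) :=
  \matrix_(i, j)
    if i == j then (degree i)%:R else - (#|edges_between i j|)%:R.

Lemma kirchhoff_sym (R : pzRingType) : (kirchhoff R)^T = kirchhoff R.
Proof.
apply/matrixP => i j; rewrite !mxE eq_sym; case: eqP => [-> //|_].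
by rewrite /edges_between setUC.
Qed.

End Quivers.

(* The roots in R of the characteristic polynomial, listed with multiplicity
   in decreasing order. *)
Definition eigenvalues (R : rcfType) (n : nat) (A : 'M[R]_n) : seq R :=
  sort >=%R (flatten
    [seq nseq (mup x (char_poly A)) x | x <- rootsR (char_poly A)]).

Lemma char_poly_conj (F : fieldType) n (P A : 'M[F]_n) : P \in unitmx ->
  char_poly (invmx P *m A *m P) = char_poly A.
Proof.
move=> uP; rewrite /char_poly /char_poly_mx.
have e : map_mx polyC (invmx P) *m map_mx polyC P = 1%:M.
  by rewrite -map_mxM mulVmx // map_scalar_mx.
have -> : 'X%:M - map_mx polyC (invmx P *m A *m P) =
  map_mx polyC (invmx P) *m ('X%:M - map_mx polyC A) *m map_mx polyC P.
  rewrite mulmxBr mulmxBl !map_mxM; congr (_ - _).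
  by rewrite scalar_mxC -mulmxA e mulmx1.
by rewrite !det_mulmx mulrAC -det_mulmx e det1 mul1r.
Qed.

Lemma char_poly_sym_split (R : rcfType) n (A : 'M[R]_n) : A^T = A ->
  exists r : seq R, char_poly A = \prod_(x <- r) ('X - x%:P).
Proof.
move=> sA; pose AC : 'M[R[i]]_n := map_mx (real_complex R) A.
have hA : AC \is hermsymmx.
  apply: realsym_hermsym; first apply/is_hermitianmxP.
    by rewrite expr0 scale1r; apply/matrixP => i j; rewrite !mxE -[in LHS]sA mxE.
  by apply/mxOverP => i j; rewrite mxE complex_real.
have /orthomx_spectralP E := hermitian_normalmx hA.
have rd := hermitian_spectral_diag_real hA.
exists [seq complex.Re (spectral_diag AC 0 i) | i <- enum 'I_n].
apply: (map_poly_inj (real_complex R)).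
rewrite map_char_poly -/AC [in LHS]E char_poly_conj ?spectral_unit //.
rewrite char_poly_trig ?diag_mx_is_trig // rmorph_prod big_map big_enum /=.
apply: eq_bigr => i _; rewrite mxE eqxx rmorphB /= map_polyX map_polyC /=.
by rewrite mulr1n (RRe_real (mxOverP rd 0 i)).
Qed.

Lemma eigenvalues_spec (R : rcfType) n (A : 'M[R]_n) : A^T = A ->
  [/\ size (eigenvalues A) = n, sorted >=%R (eigenvalues A) &
   char_poly A = \prod_(x <- eigenvalues A) ('X - x%:P)].
Proof.
move=> /char_poly_sym_split[r E].
have p0 : char_poly A != 0 by rewrite monic_neq0 // char_poly_monic.
have pe : perm_eq (eigenvalues A) r.
  rewrite /eigenvalues perm_sort.
  under eq_map => x do rewrite E mu_prod_XsubC.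
  apply: perm_trans (perm_count_undup r).
  apply: perm_flatten; apply: perm_map; apply: uniq_perm.
  - exact: uniq_roots.
  - exact: undup_uniq.
  move=> x; rewrite mem_undup -(roots_on_rootsR p0) E root_prod_XsubC.
  by rewrite inE /=.
split.
- rewrite (perm_size pe); have := congr1 (size \o polyseq) E.
  by rewrite /= size_char_poly size_prod_XsubC => -[].
- apply: sort_sorted => x y; exact: ge_total.
- by rewrite E; apply: perm_big; rewrite perm_sym.
Qed.

Section Brouwer.
Variable R : realType.

(* Indexed from 1. *)
Definition lambda (G : quiver) (j : nat) : R :=
  (eigenvalues (kirchhoff G R))`_j.-1.

Definition eigsum (G : quiver) (k : nat) : R := \sum_(1 <= j < k.+1) lambda G j.

Definition brouwer_bound (G : quiver) (k : nat) : R :=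
  (ne G)%:R + (redundancy G)%:R + k%:R * (k%:R + 1) / 2%:R.

Definition simple_estimate_upto (s : \bar R) : Prop :=
  forall G : quiver, simple G ->
  forall k : nat, (0 < k <= nv G)%N -> (k%:R%:E <= s)%E -> eigsum G k <= brouwer_bound G k.

Definition nat_or_infinity (s : \bar R) : Prop :=
  s = +oo%E \/ exists t : nat, s = t%:R%:E.

(* The threshold ranges over nat with +oo: the estimate only constrains
   integers k, and over real numbers a finite threshold would be a supremum
   that is not attained. *)
Definition is_brouwer_threshold (s : \bar R) : Prop :=
  [/\ nat_or_infinity s, simple_estimate_upto s &
      forall t : \bar R, nat_or_infinity t -> simple_estimate_upto t ->
        (t <= s)%E].

Lemma brouwer_threshold_unique (s t : \bar R) :
  is_brouwer_threshold s -> is_brouwer_threshold t -> s = t.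
Proof.
move=> [sN sP sM] [tN tP tM].
by apply/eqP; rewrite eq_le sM // tM.
Qed.

Lemma brouwer_threshold_exists : exists s : \bar R, is_brouwer_threshold s.
Proof.
have [all_ok|/existsNP fails] :=
  pselect (forall t : nat, simple_estimate_upto t%:R%:E).
  exists +oo%E; split; [by left | | by move=> t _ _; rewrite leey].
  by move=> G sG k kn _; apply: (all_ok k G sG k kn).
have exF : exists t : nat, `[< ~ simple_estimate_upto t%:R%:E >].
  by have [t Ft] := fails; exists t; apply/asboolP.
have [m /asboolP mF mmin] := find_ex_minn exF.
have lt_m (t : \bar R) : simple_estimate_upto t -> (t < m%:R%:E)%E.
  move=> tP; rewrite ltNge; apply/negP => le_mt; apply: mF => G sG k kn km.
  exact: tP kn (le_trans km le_mt).
case: m mF mmin lt_m => [[]|m mF mmin lt_m].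
  move=> G _ k /andP[k_gt0 _]; rewrite lee_fin ler_nat.
  by rewrite leqNgt k_gt0.
exists m%:R%:E; split; first by right; exists m.
- apply: contrapT => /asboolP /mmin; by rewrite ltnn.
- move=> t [->|[t' ->]] /lt_m; first by rewrite ltNge leey.
  by rewrite lte_fin ltr_nat lee_fin ler_nat ltnS.
Qed.

End Brouwer.

(* Main.v *)
Require Import Defs.
From HB Require Import structures.
From mathcomp Require Import all_boot all_order all_algebra all_fingroup.
From mathcomp Require Import spectral sesquilinear complex.
From mathcomp Require Import ring.
From mathcomp Require Import boolp reals constructive_ereal.

(** Deleting all loops and a minimal set of redundant edges leaves a simple
    graph.  Putting a deleted edge back adds a rank one term [v^T v] to the
    Kirchhoff matrix, with [v] its incidence vector; by Ky Fan's principle this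
    raises the sum of the [k] largest eigenvalues by at most [|v|^2], which is 2
    for an edge (counted in both [m] and [r]) and 1 for a loop (counted in [m]).
    So the estimate extends to all quivers for [k <= s].  For [k > s] we have
    [lambda_k <= lambda_1 <= s < k = B_k - B_(k-1)], hence induction on [k]. *)

Set Implicit Arguments.
Unset Strict Implicit.
Unset Printing Implicit Defensive.

Import Order.TTheory GRing.Theory Num.Theory.
Local Open Scope ring_scope.
Local Open Scope sesquilinear_scope.
Local Open Scope complex_scope.

(** * Ky Fan's inequality for real symmetric matrices *)

(** The column masses [a i] of the first [k] rows lie in [0,1] and have the same total as the
    indicator of [i < k]. Moving mass from larger to smaller values of [d] cannot raise the weighted
    sum. *)
Lemma sum_doubly_stochastic_le (R : realDomainType) n k
    (d : 'I_n -> R) (w : 'I_n -> 'I_n -> R) :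
    (forall i j : 'I_n, (i <= j)%N -> d j <= d i) ->
    (forall j i, 0 <= w j i) -> (forall j, \sum_i w j i = 1) ->
    (forall i, \sum_j w j i = 1) ->
  \sum_(j < n | (j < k)%N) \sum_i d i * w j i <= \sum_(i < n | (i < k)%N) d i.
Proof.
move=> d_dec w0 w_row w_col; pose a i := \sum_(j < n | (j < k)%N) w j i.
have a0 i : 0 <= a i by apply: sumr_ge0.
have a1 i : a i <= 1.
  by rewrite -(w_col i) [leRHS](bigID (fun j : 'I_n => (j < k)%N)) lerDl sumr_ge0.
(* Since the totals agree, any multiple of the difference may be added for free; a suitable [c] then
   makes the sum nonnegative term by term. *)
have eqa c : \sum_i c * (a i - (i < k)%N%:R) = 0.
  rewrite -mulr_sumr sumrB /a exchange_big /=.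
  under eq_bigr do rewrite w_row.
  rewrite [in X in _ - X](bigID (fun j : 'I_n => (j < k)%N)) /=.
  rewrite [X in _ - (_ + X)]big1 ?addr0 => [|i /negPf->//].
  by rewrite [X in _ - X](eq_bigr (fun=> 1)) ?subrr ?mulr0 // => i ->.
(* [c] separates the first [k] values from the rest: [d] at index [k], or the last value if
   [k >= n], or anything if [n = 0]. *)
have [c c_le c_ge] : exists2 c, forall i : 'I_n, (i < k)%N -> c <= d i &
    forall i : 'I_n, (k <= i)%N -> d i <= c.
  have [k_lt|k_ge] := ltnP k n.
    exists (d (Ordinal k_lt)) => i ik; apply: d_dec => //; exact: ltnW.
  have [n0|n_gt0] := posnP n.
    by exists 0 => i; have := ltn_ord i; rewrite [X in (_ < X)%N]n0.
  have n1 : (n.-1 < n)%N by rewrite prednK.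
  exists (d (Ordinal n1)) => i ik; first by apply: d_dec; rewrite /= -ltnS prednK.
  by have := ltn_ord i; rewrite ltnNge (leq_trans k_ge ik).
rewrite exchange_big /= [leRHS]big_mkcond /= -subr_ge0 -sumrB.
rewrite -[leRHS]addr0 -[X in _ + X](eqa c) -big_split /=; apply: sumr_ge0 => i _.
rewrite -mulr_sumr -/(a i); case: ltnP => [ik|ki] /=.
  have -> : d i - d i * a i + c * (a i - 1) = (d i - c) * (1 - a i) by ring.
  by rewrite mulr_ge0 ?subr_ge0 // c_le.
have -> : 0 - d i * a i + c * (a i - 0) = (c - d i) * a i by ring.
by rewrite mulr_ge0 ?subr_ge0 // c_ge.
Qed.

Lemma eigenvalues_nonincreasing (R : rcfType) n (A : 'M[R]_n) (i j : nat) :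
  A^T = A -> (i <= j < n)%N -> (eigenvalues A)`_j <= (eigenvalues A)`_i.
Proof.
move=> /eigenvalues_spec[szA srtA _] /andP[ij jn].
apply: (sorted_leq_nth (leT := >=%R)); rewrite ?inE ?szA //.
- by move=> x y z /= yx xz; apply: le_trans xz yx.
- exact: (@le_refl _ R).
- exact: leq_ltn_trans jn.
Qed.

(** The spectral theorem gives the diagonal in an unspecified order. It has the same characteristic
    polynomial as the sorted list, so permuting the rows of the unitary matrix sorts it. *)
Lemma sym_unitary_diag (R : rcfType) n (A : 'M[R]_n) : A^T = A ->
  exists2 P : 'M[R[i]]_n, P \is unitarymx &
    map_mx (real_complex R) A =
      P^t* *m diag_mx (\row_i ((eigenvalues A)`_i)%:C) *m P.
Proof.
move=> sA; pose AC : 'M[R[i]]_n := map_mx (real_complex R) A.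
have hA : AC \is hermsymmx.
  apply: realsym_hermsym; first apply/is_hermitianmxP.
    by rewrite expr0 scale1r; apply/matrixP => i j; rewrite !mxE -[in LHS]sA mxE.
  by apply/mxOverP => i j; rewrite mxE complex_real.
have /orthomx_spectralP E := hermitian_normalmx hA.
have uP := spectral_unitarymx AC.
move: E uP; rewrite (invmx_unitary (spectral_unitarymx AC)).
set P := spectralmx AC; set D := spectral_diag AC => E uP.
have [szA _ chA] := eigenvalues_spec sA.
have : perm_eq [seq x%:C | x <- eigenvalues A] [tuple D 0 i | i < n].
  apply: prod_XsubC_eq; rewrite big_map.
  transitivity (char_poly AC).
    rewrite -map_char_poly chA rmorph_prod; apply: eq_bigr => x _.
    by rewrite rmorphB /= map_polyX map_polyC.
  rewrite E -(invmx_unitary uP) char_poly_conj ?unitarymx_unit //.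
  rewrite char_poly_trig ?diag_mx_is_trig // big_map big_enum /=.
  by apply: eq_bigr => i _; rewrite mxE eqxx mulr1n.
case/tuple_permP => p Ep.
have eigE (i : 'I_n) : ((eigenvalues A)`_i)%:C = D 0 (p i).
  have -> : ((eigenvalues A)`_i)%:C = [seq x%:C | x <- eigenvalues A]`_i.
    by rewrite (nth_map 0) ?szA.
  by rewrite Ep -tnth_nth !tnth_mktuple.
exists (row_perm p P).
  apply/unitarymxP/matrixP => i j; move/unitarymxP/matrixP: uP => /(_ (p i) (p j)).
  rewrite !mxE (inj_eq perm_inj) => <-.
  by apply: eq_bigr => l _; rewrite !mxE.
rewrite [LHS]E; apply/matrixP => a b; rewrite !mul_mx_diag !mxE.
rewrite (reindex_inj (@perm_inj _ p)); apply: eq_bigr => i _.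
by rewrite !mxE eigE.
Qed.

(* In unitary eigenbases [P] of [A] and [Q] of [A + F^T F], the squared moduli
   of the entries of [Q P^*] are doubly stochastic, and the [F^T F] part
   contributes to the first [k] diagonal entries at most its full trace. *)
Lemma eigenvalues_sum_gram_le (R : rcfType) n p k (A : 'M[R]_n) (F : 'M_(p, n)) :
    A^T = A ->
  \sum_(j < n | (j < k)%N) (eigenvalues (A + F^T *m F))`_j <=
  \sum_(j < n | (j < k)%N) (eigenvalues A)`_j + \tr (F^T *m F).
Proof.
move=> sA; set B := A + _.
have sB : B^T = B by rewrite /B linearD /= trmx_mul trmxK sA.
have [P uP EA] := sym_unitary_diag sA.
have [Q uQ EB] := sym_unitary_diag sB.
pose FC := map_mx (real_complex R) F.
have FCt : FC^t* = FC^T.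
  by apply/matrixP => i j; rewrite !mxE; exact: conjc_real.
pose W := Q *m P^t*; pose H := Q *m FC^T.
have uW : W \is unitarymx by rewrite mul_unitarymx ?trmxC_unitary.
pose sq (x : R[i]) : R := complex.ComplexField.Normc.normc x ^+ 2.
have sqE x : (sq x)%:C = x * x^*.
  by rewrite -normCK rmorphXn.
have sq0 x : 0 <= sq x by rewrite sqr_ge0.
have trmxCM m1 m2 m3 (M : 'M[R[i]]_(m1, m2)) (N : 'M_(m2, m3)) :
  (M *m N)^t* = N^t* *m M^t* by rewrite trmx_mul map_mxM.
have adjE m1 m2 (M : 'M[R[i]]_(m1, m2)) i j : (M^t*) i j = (M j i)^*.
  by rewrite !mxE.
have Wt : W^t* = P *m Q^t* by rewrite /W trmxCM trmxCK.
have Ht : H^t* = FC *m Q^t* by rewrite /H trmxCM -FCt trmxCK.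
(* Both sides are the [j]-th diagonal entry of [B] conjugated by [Q], which splits along [A] and
   [F^T *m F]. *)
have diagE (j : 'I_n) : (eigenvalues B)`_j =
    \sum_(i < n) (eigenvalues A)`_i * sq (W j i) + \sum_l sq (H j l).
  apply: (@complexI R).
  have : (Q *m map_mx (real_complex R) B *m Q^t*) j j =
      (W *m diag_mx (\row_i ((eigenvalues A)`_i)%:C) *m W^t* + H *m H^t*) j j.
    congr (fun_of_matrix _ j j).
    rewrite Wt Ht /W /H /B map_mxD map_mxM -map_trmx EA -/FC.
    by rewrite mulmxDr mulmxDl !mulmxA.
  rewrite EB !mulmxA (unitarymxP uQ) mul1mx -mulmxA (unitarymxP uQ) mulmx1.
  rewrite !mxE eqxx mulr1n => ->.
  rewrite rmorphD !rmorph_sum /=; congr (_ + _); apply: eq_bigr => i _.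
    by rewrite mul_mx_diag !mxE rmorphM /= sqE mulrCA mulrA.
  by rewrite adjE; exact/esym/sqE.
rewrite (eq_bigr _ (fun j _ => diagE j)) big_split /=; apply: lerD.
  apply: (@sum_doubly_stochastic_le _ _ _ (fun i : 'I_n => (eigenvalues A)`_i)) => //.
  - by move=> i j ij; rewrite eigenvalues_nonincreasing // ij ltn_ord.
  - move=> j; apply: (@complexI R); rewrite rmorph_sum.
    transitivity ((W *m W^t*) j j); last by rewrite (unitarymxP uW) mxE eqxx.
    by rewrite mxE; apply: eq_bigr => i _; rewrite adjE; exact: sqE.
  (* Column sums are row sums for the adjoint of [W], again unitary. *)
  - move=> i; apply: (@complexI R); rewrite rmorph_sum.
    transitivity ((W^t* *m W^t*^t*) i i).
      rewrite mxE; apply: eq_bigr => j _.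
      by rewrite !adjE -normCK norm_conjC normCK; exact: sqE.
    by move: uW; rewrite -trmxC_unitary => /unitarymxP->; rewrite mxE eqxx.
have -> : \tr (F^T *m F) = \sum_j \sum_l sq (H j l).
  apply: (@complexI R); rewrite -trace_map_mx map_mxM -map_trmx -/FC.
  transitivity (\tr (H *m H^t*)).
    have QQ : Q^t* *m Q = 1%:M by rewrite -invmx_unitary ?mulVmx ?unitarymx_unit.
    by rewrite Ht /H !mulmxA [RHS]mxtrace_mulC !mulmxA QQ mul1mx.
  rewrite /mxtrace rmorph_sum; apply: eq_bigr => j _.
  by rewrite rmorph_sum !mxE; apply: eq_bigr => l _; rewrite adjE; exact/esym/sqE.
(* The trace also contains the nonnegative terms with [j >= k]. *)
rewrite [leRHS](bigID (fun j : 'I_n => (j < k)%N)) lerDl.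
by apply: sumr_ge0 => j _; apply: sumr_ge0.
Qed.

(** * Incidence vectors and removal of edges *)

(* The first endpoint carries the sign [+1] and the other one [-1]; a loop only
   has the entry [+1]. *)
Definition incidence (R : pzRingType) n (S : {set 'I_n}) (i : 'I_n) : R :=
  (i \in S)%:R * (-1) ^+ ([pick a in S] != Some i).

Lemma incidenceM (R : comPzRingType) n (S : {set 'I_n}) (i j : 'I_n) :
    (#|S| <= 2)%N ->
  incidence R S i * incidence R S j =
  if i == j then (i \in S)%:R else - (S == [set i; j])%:R.
Proof.
rewrite /incidence => S2; have [->|ij] := eqVneq i j.
  by rewrite mulrACA -[X in _ * X]expr2 sqrr_sign mulr1 -natrM mulnb andbb.
have [SE|SN] := eqVneq S [set i; j]; last first.
  (* A set of at most two vertices containing both [i] and [j] would equal [[set i; j]]. *)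
  suff /nandP[/negPf->|/negPf->] : ~~ ((i \in S) && (j \in S)).
    by rewrite !mul0r oppr0.
  - by rewrite mul0r mulr0 oppr0.
  apply: contraNN SN => /andP[iS jS]; rewrite eq_sym eqEcard cards2 ij S2 andbT.
  by apply/subsetP => x /set2P[]->.
case: pickP => [a|/(_ i)]; last by rewrite SE set21.
rewrite SE set21 set22 !mul1r => /set2P[]->; rewrite eqxx /= ?mul1r ?mulr1.
  by rewrite (inj_eq Some_inj) ij.
by rewrite (inj_eq Some_inj) eq_sym ij.
Qed.

Lemma kirchhoff_incidence (R : comPzRingType) (G : quiver) i j :
  kirchhoff G R i j =
  \sum_(e : edge G) incidence R (ends e) i * incidence R (ends e) j.
Proof.
rewrite mxE; under eq_bigr => e _.
  rewrite incidenceM; last by case/andP: (card_ends e).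
  over.
case: eqP => _; rewrite ?sumrN -natr_sum /degree /edges_between -sum1dep_card.
  by congr _%:R; rewrite big_mkcond; apply: eq_bigr => e _; case: ifP.
by congr (- _%:R); rewrite big_mkcond; apply: eq_bigr => e _; case: ifP.
Qed.

(** All vertices are kept, so both Kirchhoff matrices have the same size. *)
Definition remove_edges (G : quiver) (X : {set edge G}) : quiver :=
  @Quiver (nv G) {e | e \in ~: X} (fun e => ends (val e)) (nv_gt0 G)
    (fun e => card_ends (val e)).

Section RemoveEdges.
Variables (G : quiver) (X : {set edge G}).

Lemma ne_remove_edges : (ne (remove_edges X) + #|X|)%N = ne G.
Proof.
by rewrite /ne card_sig addnC -(cardsC X); congr addn; apply: eq_card.
Qed.

Lemma edges_between_remove i j :
  #|edges_between (G := remove_edges X) i j| =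
  #|edges_between (G := G) i j :\: X|.
Proof.
rewrite -(card_imset _ val_inj); apply: eq_card => e.
apply/imsetP/setDP => [[e' + ->]|[+ eX]].
  by have := valP e'; rewrite !inE.
have XCe : e \in ~: X by rewrite inE.
by rewrite inE => eij; exists (exist _ e XCe); rewrite ?inE.
Qed.

Definition incidence_mx (R : pzRingType) : 'M[R]_(#|X|, nv G) :=
  \matrix_(l, i) incidence R (ends (enum_val l)) i.

Lemma kirchhoff_remove_edges (R : comPzRingType) :
  kirchhoff G R =
  kirchhoff (remove_edges X) R + (incidence_mx R)^T *m incidence_mx R.
Proof.
apply/matrixP => i j; rewrite [RHS]mxE !kirchhoff_incidence [X in _ + X]mxE.
under [X in _ + X]eq_bigr => l _ do rewrite !mxE.
pose f e := incidence R (ends e) i * incidence R (ends e) j.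
rewrite -(big_enum_val f) -(big_sub (mem (~: X)) f).
rewrite [LHS](bigID [in X]) addrC /=; congr (_ + _).
by apply: eq_bigl => e; rewrite inE.
Qed.

(** An incidence vector has entries 1 or -1 exactly at the endpoints, so its squared norm counts
    them. *)
Lemma mxtrace_incidence (R : comPzRingType) :
  \tr ((incidence_mx R)^T *m incidence_mx R) = (\sum_(e in X) #|ends e|)%:R.
Proof.
transitivity (\sum_(i < nv G) \sum_(e in X) incidence R (ends e) i ^+ 2).
  apply: eq_bigr => i _; rewrite mxE [RHS]big_enum_val.
  by apply: eq_bigr => l _; rewrite !mxE.
rewrite exchange_big natr_sum /=; apply: eq_bigr => e _.
rewrite -sum1_card natr_sum [RHS]big_mkcond /=; apply: eq_bigr => i _.
by rewrite expr2 incidenceM ?eqxx; [case: ifP | case/andP: (card_ends e)].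
Qed.

End RemoveEdges.

(** * Reduction to simple graphs *)

Lemma no_multiple_redundancy (G : quiver) :
  exists2 D : {set edge G}, no_multiple (~: D) & redundancy G = #|D|.
Proof.
rewrite /redundancy; case: arg_minnP => [|D D_ok _]; last by exists D.
by apply/forallP => i; apply/forallP => j; rewrite setCT setI0 cards0 implybT.
Qed.

Lemma redundancy_simple (G : quiver) : simple G -> redundancy G = 0%N.
Proof.
case/andP=> _ G1; rewrite /redundancy; case: arg_minnP => [|D _ /(_ set0)].
  by apply/forallP => i; apply/forallP => j; rewrite setCT setI0 cards0 implybT.
by rewrite setC0 G1 cards0 leqn0 => /(_ isT)/eqP.
Qed.

Definition loops (G : quiver) : {set edge G} := [set e | #|ends e| == 1%N].

Lemma simple_remove_edges (G : quiver) (D : {set edge G}) :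
  no_multiple (~: D) -> simple (remove_edges (D :|: loops G)).
Proof.
move=> /forallP D1; apply/andP; split; apply/forallP.
  case=> e /=; rewrite !inE negb_or => /andP[_].
  by case/andP: (card_ends e); case: #|_| => [|[|[|]]].
move=> i; apply/forallP => j; apply/implyP => ij; rewrite setIT.
rewrite edges_between_remove setDE.
have /forallP/(_ j)/implyP/(_ ij) := D1 i; apply: leq_trans.
by apply: subset_leq_card; rewrite setIS // setCS subsetUl.
Qed.

(** Every removed edge pays 1 through the first term. Only an edge of [D] can have a second endpoint
    to pay for, since the others are loops. *)
Lemma sum_card_ends_le (G : quiver) (D : {set edge G}) :
  (\sum_(e in D :|: loops G) #|ends e| <= #|D :|: loops G| + #|D|)%N.
Proof.
rewrite -[#|D|]sum1_card (big_mkcond [in D]) /= -[X in (_ <= X + _)%N]sum1_card.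
rewrite [X in (_ <= _ + X)%N](bigID [in D :|: loops G]) /= addnA -big_split /=.
apply: leq_trans (leq_addr _ _); apply: leq_sum => e.
rewrite !inE; case: (e \in D) => [_|/= /eqP->//].
by case/andP: (card_ends e).
Qed.

Lemma eigsumE (R : realType) (G : quiver) k : (k <= nv G)%N ->
  eigsum R G k = \sum_(j < nv G | (j < k)%N) (eigenvalues (kirchhoff G R))`_j.
Proof.
move=> kn; rewrite /eigsum big_add1 /= big_mkord.
by rewrite (big_ord_widen _ (fun j => (eigenvalues (kirchhoff G R))`_j) kn).
Qed.

Lemma quiver_estimate_upto (R : realType) (s : \bar R) :
    simple_estimate_upto s ->
  forall (G : quiver) (k : nat), (0 < k <= nv G)%N -> (k%:R%:E <= s)%E ->
    eigsum R G k <= brouwer_bound R G k.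
Proof.
move=> simple_le G k kn ks; have [D D1 Dr] := no_multiple_redundancy G.
have := simple_le _ (simple_remove_edges D1) k kn ks.
rewrite /brouwer_bound redundancy_simple ?simple_remove_edges // addr0 Dr.
rewrite -(ne_remove_edges (D :|: loops G)).
have [_ kn'] := andP kn; rewrite !eigsumE // => S_le.
rewrite [kirchhoff G R](kirchhoff_remove_edges (D :|: loops G)).
have gram_le := eigenvalues_sum_gram_le k (incidence_mx (D :|: loops G) R)
  (kirchhoff_sym (remove_edges (D :|: loops G)) R).
apply: le_trans gram_le _; apply: le_trans (lerD S_le (lexx _)) _.
(* The kept edges and [k(k+1)/2] cancel; the trace must be at most the number of removed edges plus
   [#|D|]. *)
rewrite mxtrace_incidence addrAC lerD2r natrD -!addrA lerD2l -natrD ler_nat.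
exact: sum_card_ends_le.
Qed.

Theorem corollary1 (R : realType) (s : \bar R)
    (s_threshold : is_brouwer_threshold s) (G : quiver)
    (le_lambda_s : ((lambda R G 1)%:E <= s)%E)
    (k : nat) (k_range : (0 < k <= nv G)%N) :
  eigsum R G k <= brouwer_bound R G k.
Proof.
case: s_threshold => _ simple_le _; case/andP: k_range => _.
(* The induction starts at the empty sum [k = 0], where the bound is [m + r >= 0]. *)
elim: k => [|k IHk] kn.
  by rewrite /eigsum big_geq // /brouwer_bound !mul0r addr0 -natrD.
have [ks|s_lt] := leP (k.+1%:R%:E) s.
  exact: quiver_estimate_upto simple_le _ _ _ ks.
have lambda_le : lambda R G k.+1 <= k.+1%:R.
  rewrite -lee_fin; apply: le_trans (ltW s_lt); apply: le_trans le_lambda_s.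
  by rewrite lee_fin eigenvalues_nonincreasing ?kirchhoff_sym.
rewrite /eigsum big_nat_recr //= -/(eigsum R G k).
have -> : brouwer_bound R G k.+1 = brouwer_bound R G k + k.+1%:R.
  by rewrite /brouwer_bound -natr1; field.
by rewrite lerD // IHk // ltnW.
Qed.
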